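(* The following soundness and completeness results hold: (1) $\mathbf{E}^W$ is sound and strongly complete with respect to the class of $(n)$-frames; (2) $\mathbf{M}^W$ is sound and strongly complete with respect to the class of $(mn)$-frames; (3) $\mathbf{EC}^W$ is sound and strongly complete with respect to the class of $(cn)$-frames.
   Context: Fix a nonempty set $\mathbf{P}$ of propositional variables, $p\in\mathbf{P}$. $\mathcal{L}(W)$: $\varphi::=p\mid\neg\varphi\mid\varphi\land\varphi\mid W\varphi$; other Boolean connectives are defined as usual. A neighborhood frame is $\langle S,N\rangle$ with $S$ a nonempty set and $N:S\to\mathcal{P}(\mathcal{P}(S))$; a model $\mathcal{M}=\langle S,N,V\rangle$ based on it adds $V:\mathbf{P}\to\mathcal{P}(S)$. With $\varphi^{\mathcal{M}}=\{s\in S\mid\mathcal{M},s\vDash\varphi\}$: $\mathcal{M},s\vDash p$ iff $s\in V(p)$; Boolean connectives as usual; $\mathcal{M},s\vDash W\varphi$ iff $\varphi^{\mathcal{M}}\in N(s)$ and $s\notin\varphi^{\mathcal{M}}$. Frame properties (for all $s\in S$): $(m)$ $X\in N(s)$ and $X\subseteq Y\subseteq S$ imply $Y\in N(s)$; $(c)$ $X,Y\in N(s)$ imply $X\cap Y\in N(s)$; $(n)$ $S\in N(s)$. An $(n)$-frame has $(n)$; an $(mn)$-frame has $(m)$ and $(n)$; a $(cn)$-frame has $(c)$ and $(n)$. Proof systems for $\mathcal{L}(W)$: $\mathbf{E}^W$ has as axioms all instances of propositional tautologies and of $\texttt{WE}$: $W\varphi\to\neg\varphi$, and as rules modus ponens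 and $\texttt{REW}$: from $\varphi\leftrightarrow\psi$ infer $W\varphi\leftrightarrow W\psi$ (applied to theorems). $\mathbf{M}^W$ is $\mathbf{E}^W$ plus all instances of $\texttt{WM}$: $W(\varphi\land\psi)\land\neg\psi\to W\psi$. $\mathbf{EC}^W$ is $\mathbf{E}^W$ plus all instances of $\texttt{WC}$: $W\varphi\land W\psi\to W(\varphi\land\psi)$. Sound with respect to a class of frames: every theorem is true at every state of every model based on a frame in the class. Strongly complete: for every set $\Gamma\cup\{\varphi\}$ of formulas, if $\varphi$ is true at every state, in every model based on a frame in the class, at which all of $\Gamma$ is true, then $\vdash\bigwedge\Gamma_0\to\varphi$ for some finite $\Gamma_0\subseteq\Gamma$ (equivalently, every consistent set is satisfiable in a model based on a frame in the class). *)

(* Defs.v *)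
From mathcomp Require Import all_boot.
From mathcomp Require Import boolp classical_sets.
From Stdlib Require List.

Set Implicit Arguments.
Unset Strict Implicit.
Unset Printing Implicit Defensive.

Local Open Scope classical_set_scope.

Section Syntax.
Variable P : Type.

Inductive form : Type :=
  | Var of P
  | Neg of form
  | And of form & form
  | W of form.

Definition Or (a b : form) : form := Neg (And (Neg a) (Neg b)).
Definition Imp (a b : form) : form := Neg (And a (Neg b)).
Definition Iff (a b : form) : form := And (Imp a b) (Imp b a).
Definition Top (p : P) : form := Or (Var p) (Neg (Var p)).

(* [p] only serves to express the empty conjunction. *)
Definition bigAnd (p : P) (l : seq form) : form := foldr And (Top p) l.

End Syntax.

(* Purely propositional formulas, whose instances under substitutions
   [nat -> form P] are the tautological axioms; countably many schematic
   letters are used whatever the size of [P]. *)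
Inductive pform : Type :=
  | PVar of nat
  | PNeg of pform
  | PAnd of pform & pform.

Fixpoint peval (v : nat -> bool) (a : pform) : bool :=
  match a with
  | PVar i => v i
  | PNeg b => ~~ peval v b
  | PAnd b c => peval v b && peval v c
  end.

Definition tautology (a : pform) : Prop := forall v, peval v a.

Fixpoint psubst (P : Type) (f : nat -> form P) (a : pform) : form P :=
  match a with
  | PVar i => f i
  | PNeg b => Neg (psubst f b)
  | PAnd b c => And (psubst f b) (psubst f c)
  end.

Section ProofSystems.
Variable P : Type.

Definition taut_instance (a : form P) : Prop :=
  exists (t : pform) (f : nat -> form P), tautology t /\ a = psubst f t.

Definition WE (a : form P) : Prop :=
  exists b, a = Imp (W b) (Neg b).

Definition WM (a : form P) : Prop :=
  exists b c, a = Imp (And (W (And b c)) (Neg c)) (W c).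

Definition WC (a : form P) : Prop :=
  exists b c, a = Imp (And (W b) (W c)) (W (And b c)).

(* Theorems of the extension of E^W by the axioms [Ax]. *)
Inductive provable (Ax : form P -> Prop) : form P -> Prop :=
  | prov_taut a : taut_instance a -> provable Ax a
  | prov_WE a : WE a -> provable Ax a
  | prov_ax a : Ax a -> provable Ax a
  | prov_MP a b : provable Ax (Imp a b) -> provable Ax a -> provable Ax b
  | prov_REW a b : provable Ax (Iff a b) -> provable Ax (Iff (W a) (W b)).

Definition EW : form P -> Prop := provable (fun=> False).
Definition MW : form P -> Prop := provable WM.
Definition ECW : form P -> Prop := provable WC.

End ProofSystems.

Record frame : Type := Frame {
  state :> Type;
  state_nonempty : inhabited state;
  nbhd : state -> set (set state)
}.

Definition frame_m (F : frame) : Prop :=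
  forall (s : F) (X Y : set F), nbhd s X -> X `<=` Y -> nbhd s Y.

Definition frame_c (F : frame) : Prop :=
  forall (s : F) (X Y : set F), nbhd s X -> nbhd s Y -> nbhd s (X `&` Y).

Definition frame_n (F : frame) : Prop := forall s : F, nbhd s setT.

Definition frame_mn (F : frame) : Prop := frame_m F /\ frame_n F.
Definition frame_cn (F : frame) : Prop := frame_c F /\ frame_n F.

Section Semantics.
Variable P : Type.

Record model : Type := Model {
  model_frame :> frame;
  valuation : P -> set model_frame
}.

Fixpoint sat (M : model) (s : M) (a : form P) {struct a} : Prop :=
  match a with
  | Var p => valuation p s
  | Neg b => ~ sat s b
  | And b c => sat s b /\ sat s c
  | W b => nbhd s [set t : M | sat t b] /\ ~ [set t : M | sat t b] s
  end.

Definition sound (L : form P -> Prop) (C : frame -> Prop) : Prop :=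
  forall a, L a -> forall M : model, C M -> forall s : M, sat s a.

Definition entails (C : frame -> Prop) (G : set (form P)) (a : form P) : Prop :=
  forall M : model, C M -> forall s : M, (forall b, G b -> sat s b) -> sat s a.

(* The finite subsets of [G] are given by lists. *)
Definition strongly_complete (p : P) (L : form P -> Prop)
    (C : frame -> Prop) : Prop :=
  forall (G : set (form P)) (a : form P), entails C G a ->
    exists l : seq (form P),
      (forall b, List.In b l -> G b) /\ L (Imp (bigAnd p l) a).

End Semantics.

(* Main.v *)
Require Import Defs.
From mathcomp Require Import all_boot.
From mathcomp Require Import boolp classical_sets.
From Stdlib Require List.

Set Implicit Arguments.
Unset Strict Implicit.
Unset Printing Implicit Defensive.

(* A set of formulas that does not derive [a] extends, by Zorn, to a maximal
   such set, which is a complete theory; the complete theories are the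
   states of a canonical model. A state [s] has as neighborhoods the truth
   sets [|b|] with [W b] in [s], together with the whole space. Adding the
   whole space is harmless because [W b] requires [b] to fail at [s], so the
   truth lemma survives and [(n)] comes for free. For [M^W] one closes the
   neighborhoods under supersets, [WM] being what the truth lemma then
   needs; for [EC^W], [WC] gives closure under intersections. *)

(** * Propositional reasoning by Boolean evaluation *)

Section Propositional.
Variable P : Type.
Implicit Types (a b : form P) (v : {classic form P} -> bool).

(** Formulas [W b] count as atoms here, hence valuations on formulas; [{classic form P}] provides
    the equality test behind [index]. *)
Fixpoint bval v a : bool :=
  match a with
  | Neg b => ~~ bval v b
  | And b c => bval v b && bval v c
  | Var _ | W _ => v a
  end.

Fixpoint atoms a : seq {classic form P} :=
  match a with
  | Neg b => atoms b
  | And b c => atoms b ++ atoms c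
  | Var _ | W _ => [:: a]
  end.

Fixpoint skeleton (s : seq {classic form P}) a : pform :=
  match a with
  | Neg b => PNeg (skeleton s b)
  | And b c => PAnd (skeleton s b) (skeleton s c)
  | Var _ | W _ => PVar (index (a : {classic form P}) s)
  end.

Lemma psubst_skeleton (x0 : form P) (s : seq {classic form P}) a :
  {subset atoms a <= s} ->
  psubst (fun i => nth (x0 : {classic form P}) s i) (skeleton s a) = a.
Proof.
elim: a => [q|a IHa|a IHa b IHb|a IHa] /= sub.
- by rewrite nth_index // sub ?mem_head.
- by rewrite IHa.
- by rewrite IHa ?IHb // => x xin; apply: sub; rewrite mem_cat xin ?orbT.
- by rewrite nth_index // sub ?mem_head.
Qed.

Lemma peval_skeleton (w : nat -> bool) (s : seq {classic form P}) a :
  peval w (skeleton s a) = bval (fun x => w (index x s)) a.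
Proof. by elim: a => //= [a ->|a -> b ->]. Qed.

(** A valuation of the letters of the skeleton induces, through [index], a valuation of formulas.
    Propositional steps thus reduce to Boolean computation. *)
Lemma taut_instance_bval a : (forall v, bval v a) -> taut_instance a.
Proof.
move=> av; exists (skeleton (atoms a) a).
exists (fun i => nth (a : {classic form P}) (atoms a) i).
by split=> [w|]; rewrite ?peval_skeleton ?psubst_skeleton.
Qed.

Lemma bval_Imp v a b : bval v (Imp a b) = (bval v a ==> bval v b).
Proof. by rewrite /= negb_and negbK implybE. Qed.

Lemma bval_bigAnd v p (l : seq (form P)) :
  bval v (bigAnd p l) = all (bval v) l.
Proof. by elim: l => [|b l /= ->] //=; case: (v _). Qed.

End Propositional.

(** * Derivability from sets and the Lindenbaum lemma *)

Section Derivability.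
Local Open Scope classical_set_scope.
Variables (P : Type) (p : P) (Ax : form P -> Prop).
Implicit Types (a b c : form P) (G H : set (form P)).

Lemma provable_taut a : (forall v, bval v a) -> provable Ax a.
Proof. by move=> av; apply/prov_taut/taut_instance_bval. Qed.

Lemma provable_conseq a b :
  (forall v, bval v a -> bval v b) -> provable Ax a -> provable Ax b.
Proof.
move=> ab; apply: prov_MP; apply: provable_taut => v.
by rewrite bval_Imp; apply/implyP/ab.
Qed.

Lemma provable_conseq2 a b c :
    (forall v, bval v a -> bval v b -> bval v c) ->
  provable Ax a -> provable Ax b -> provable Ax c.
Proof.
move=> abc pa; apply: prov_MP; apply: provable_conseq pa => v va.
by rewrite bval_Imp; apply/implyP/abc.
Qed.

Definition derives G a : Prop :=
  exists l : seq (form P),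
    (forall b, List.In b l -> G b) /\ provable Ax (Imp (bigAnd p l) a).

Lemma provable_derives G a : provable Ax a -> derives G a.
Proof.
move=> pa; exists [::]; split=> //; apply: provable_conseq pa => v va.
by rewrite bval_Imp va implybT.
Qed.

Lemma derives_in G a : G a -> derives G a.
Proof.
move=> Ga; exists [:: a]; split=> [b [<-|[]]//|]; apply: provable_taut => v.
by rewrite bval_Imp bval_bigAnd /= andbT implybb.
Qed.

Lemma derives_conseq2 G a b c :
    (forall v, bval v a -> bval v b -> bval v c) ->
  derives G a -> derives G b -> derives G c.
Proof.
move=> abc [l [lG la]] [m [mG mb]]; exists (l ++ m)%SEQ; split.
  by move=> d /List.in_app_iff[/lG|/mG].
apply: provable_conseq2 la mb => v.
rewrite !bval_Imp !bval_bigAnd all_cat.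
by case: (all _ l) (all _ m) => [] [] //= va vb; apply: abc.
Qed.

Lemma derives_conseq G a b :
  (forall v, bval v a -> bval v b) -> derives G a -> derives G b.
Proof. by move=> ab Ga; apply: (derives_conseq2 _ Ga Ga) => v /ab. Qed.

Lemma derives_MP G a b : derives G (Imp a b) -> derives G a -> derives G b.
Proof.
by apply: derives_conseq2 => v; rewrite bval_Imp => /implyP.
Qed.

Lemma derives_deduction G a b :
  derives (a |` G) b -> derives G (Imp a b).
Proof.
move=> [l [lG lb]].
(* [m] keeps the entries of [l] that come from [G] and drops the copies of [a]. *)
suff [m [mG ml]] : exists m, (forall c, List.In c m -> G c) /\
    forall v, bval v a -> all (bval v) m -> all (bval v) l.
  exists m; split=> //; apply: provable_conseq lb => v.
  rewrite !bval_Imp !bval_bigAnd => /implyP lb; apply/implyP => vm.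
  by apply/implyP => va; apply/lb/ml.
elim: l lG {lb} => [|c l IHl] lG; first by exists [::].
have [c' c'l|m [mG ml]] := IHl; first by apply: lG; right.
have [->|Gc] : (a |` G) c by apply: lG; left.
  by exists m; split=> // v va vm /=; rewrite va ml.
exists (c :: m); split=> [d [<-//|/mG//]|v va /= /andP[-> vm]].
by rewrite ml.
Qed.

(** In [theory_Neg], left to right is consistency and right to left is maximality. *)
Record complete_theory G : Prop := CompleteTheory {
  theory_closed a : derives G a -> G a;
  theory_Neg a : G (Neg a) <-> ~ G a
}.

Lemma lindenbaum G a : ~ derives G a ->
  exists H, [/\ complete_theory H, G `<=` H & ~ H a].
Proof.
move=> nGa.
have [F Fproper Fchain [l [lGF la]]|H [nHa Hmax]] :=
  @Zorn_bigcup _ [set H | ~ derives (G `|` H) a].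
  (* The list is finite, so a single member of the chain suffices for it; [set0] covers the empty
     chain. *)
  suff [Y [[->|FY] lGY]] : exists Y, (Y = set0 \/ F Y) /\
      forall b, List.In b l -> (G `|` Y) b.
  - by apply: nGa; exists l; split=> // b /lGY[].
  - by apply: (Fproper Y) => //; exists l.
  elim: l lGF {la} => [|b l IHl] lGF; first by exists set0; split; [left|].
  have [c cl|Y [FY lGY]] := IHl; first by apply: lGF; right.
  have [Gb|[X FX Xb]] : (G `|` \bigcup_(X in F) X) b by apply: lGF; left.
    by exists Y; split=> // c [<-|/lGY//]; left.
  have [YX|XY] : Y `<=` X \/ X `<=` Y.
    by case: FY => [->|FY]; [left; exact: sub0set|exact: Fchain].
  - exists X; split; first by right.
    by move=> c [<-|/lGY[]]; [right|left|right; exact: YX].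
  - by exists Y; split=> // c [<-|/lGY//]; right; exact: XY.
set T := G `|` H in nHa.
(* By maximality, adding to [T] a formula outside it makes [a] derivable. Were [b] and [Neg b] both
   outside, [a] would follow by cases. *)
have T_Imp b : ~ T b -> derives T (Imp b a).
  move=> nTb; apply: derives_deduction; rewrite setUCA.
  apply: contrapT; apply: Hmax; split=> [c|sub]; first by right.
  by apply: nTb; right; apply: sub; left.
exists T; split; last by move=> /derives_in.
  split=> b.
    move=> Tb; apply: contrapT => /T_Imp Tba.
    exact/nHa/(derives_MP Tba).
  split=> [/derives_in TNb /derives_in Tb|/T_Imp Tba].
    by apply/nHa/(derives_conseq2 _ TNb Tb) => v /= /negbTE ->.
  apply: contrapT => /T_Imp TNba; apply: nHa.
  apply: (derives_conseq2 _ Tba TNba) => v.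
  by rewrite !bval_Imp /=; case: (bval v b).
by move=> b Gb; left.
Qed.

End Derivability.

(** * Canonical models and the truth lemma *)

Section Canonical.
Local Open Scope classical_set_scope.
Variables (P : Type) (p : P) (Ax : form P -> Prop).
Implicit Types (a b c : form P).

Notation complete := (complete_theory p Ax).

Definition theory : Type := {G : set (form P) | complete G}.
Implicit Type s : theory.

Lemma theory_derives s a : derives p Ax (sval s) a -> sval s a.
Proof. exact: (theory_closed (svalP s)). Qed.

Lemma theory_NegE s a : sval s (Neg a) <-> ~ sval s a.
Proof. exact: (theory_Neg (svalP s)). Qed.

Lemma theory_AndE s a b : sval s (And a b) <-> sval s a /\ sval s b.
Proof.
split=> [/(derives_in p Ax) sab|[/(derives_in p Ax) sa /(derives_in p Ax) sb]].
  by split; apply: theory_derives;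
    apply: (derives_conseq _ sab) => v /= /andP[].
by apply: theory_derives; apply: (derives_conseq2 _ sa sb) => v /= -> ->.
Qed.

Lemma theory_MP s a b : provable Ax (Imp a b) -> sval s a -> sval s b.
Proof.
move=> /(provable_derives p (sval s)) sab /(derives_in p Ax) sa.
exact/theory_derives/(derives_MP sab).
Qed.

Lemma theory_W_Neg s a : sval s (W a) -> ~ sval s a.
Proof.
by move=> sWa; apply/theory_NegE/(theory_MP _ sWa)/prov_WE; exists a.
Qed.

Lemma theory_W_iff s a b :
    provable Ax (Imp a b) -> provable Ax (Imp b a) ->
  sval s (W a) -> sval s (W b).
Proof.
move=> ab ba; apply: theory_MP.
have /prov_REW : provable Ax (Iff a b).
  by apply: provable_conseq2 ab ba => v /= -> ->.
by apply: provable_conseq => v /= /andP[].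
Qed.

Definition truth_set a : set theory := [set s | sval s a].

(** If [a] does not prove [b], Lindenbaum yields a state containing [a] and omitting [b]. *)
Lemma truth_set_sub a b :
  truth_set a `<=` truth_set b -> provable Ax (Imp a b).
Proof.
move=> ab; apply: contrapT => nab.
have [|H [Hth aH nHb]] := @lindenbaum _ p Ax [set a] b.
  move=> aDb; apply: nab.
  have [l [l0 lab]] : derives p Ax set0 (Imp a b).
    by apply: derives_deduction; rewrite setU0.
  (* Only the empty list has all its entries in [set0]; its conjunction [Top p] is a tautology and
     can be discharged. *)
  case: l l0 lab => [_|c l /(_ c (or_introl erefl))[]].
  by apply: provable_conseq => v /=; case: (v (Var p)) => /=; rewrite negbK.
by apply/nHb/(ab (exist _ H Hth))/aH.
Qed.

Lemma truth_set_And a b :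
  truth_set (And a b) = truth_set a `&` truth_set b.
Proof. by apply/seteqP; split=> s; case: (theory_AndE s a b). Qed.

(** Equal truth sets mean provable equivalence, so [REW] applies. Neighborhoods can therefore be
    given by truth sets, whatever formula names them. *)
Lemma truth_set_W s a b :
  truth_set a = truth_set b -> sval s (W a) -> sval s (W b).
Proof. by move=> ab; apply: theory_W_iff; apply: truth_set_sub; rewrite ab. Qed.

(** Shared by the three logics: the first hypothesis is the [W] case of the truth lemma. The second
    assumes [inhabited theory] because a state is only available once Lindenbaum has been applied to
    an underivable [a]. *)
Lemma strongly_complete_canonical (N : theory -> set (set theory))
    (C : frame -> Prop) :
    (forall s a, (N s (truth_set a) /\ ~ sval s a) <-> sval s (W a)) ->
    (forall s0 : inhabited theory, C (Frame s0 N)) ->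
  strongly_complete p (provable Ax) C.
Proof.
move=> NW CN G a Ga; apply: contrapT.
move=> /(@lindenbaum _ p Ax G a)[H [Hth GH nHa]].
pose s0 : theory := exist _ H Hth.
pose M := @Model P (Frame (inhabits s0) N) (fun q => truth_set (Var q)).
(* Stated as an equality of sets, so that it rewrites inside [nbhd]. *)
have truth b : [set t : M | sat t b] = truth_set b.
  elim: b => [q|b IHb|b IHb c IHc|b IHb] //=.
  - apply/seteqP; split=> s /=; rewrite [truth_set _ _]theory_NegE;
    by rewrite -[sval s b]/(truth_set b s) -IHb.
  - by rewrite truth_set_And -IHb -IHc.
  - apply/seteqP; split=> s;
    rewrite /= -[@sat _ M s b]/([set t : M | sat t b] s) IHb; by case: (NW s b).
have satE (s : M) b : sat s b = sval s b.
  by rewrite -[RHS]/(truth_set b s) -truth.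
apply: nHa; rewrite -[H]/(sval s0) -[sval s0 a](satE s0).
by apply: Ga => [|b Gb]; [exact: CN|rewrite satE; exact: GH].
Qed.

Definition min_nbhd s : set (set theory) :=
  [set X | X = setT \/ exists2 b, sval s (W b) & X = truth_set b].

Lemma min_nbhdP s a :
  (min_nbhd s (truth_set a) /\ ~ sval s a) <-> sval s (W a).
Proof.
split=> [[[aT|[b sWb ab]] nsa]|sWa].
- by case: nsa; rewrite -[sval s a]/(truth_set a s) aT.
- exact: truth_set_W (esym ab) sWb.
- by split; [right; exists a|exact: theory_W_Neg].
Qed.

Definition mon_nbhd s : set (set theory) :=
  [set X | exists2 Y, min_nbhd s Y & Y `<=` X].

Lemma mon_nbhdP s a : (forall b, WM b -> Ax b) ->
  (mon_nbhd s (truth_set a) /\ ~ sval s a) <-> sval s (W a).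
Proof.
move=> AxWM; split=> [[[_ [->|[b sWb ->]] ba] nsa]|sWa].
- by case: nsa; apply: (ba s).
(* As the truth set of [b] lies in that of [a], [b] and [And b a] have the same truth set, so [W b]
   gives [W (And b a)]. *)
- apply: (@theory_MP s (And (W (And b a)) (Neg a))).
    by apply/prov_ax/AxWM; exists b, a.
  apply/theory_AndE; split; last exact/theory_NegE.
  by apply: truth_set_W sWb; rewrite truth_set_And; apply/esym/setIidl.
- have [ma nsa] := (min_nbhdP s a).2 sWa.
  by split=> //; exists (truth_set a).
Qed.

Lemma min_nbhd_setI s (X Y : set theory) : (forall b, WC b -> Ax b) ->
  min_nbhd s X -> min_nbhd s Y -> min_nbhd s (X `&` Y).
Proof.
move=> AxWC [->|[b sWb ->]]; first by rewrite setTI.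
move=> [->|[c sWc ->]]; first by rewrite setIT; right; exists b.
right; exists (And b c); last by rewrite truth_set_And.
apply: (@theory_MP s (And (W b) (W c))); last exact/theory_AndE.
by apply/prov_ax/AxWC; exists b, c.
Qed.

End Canonical.

(** * Soundness of the axioms and rules *)

Section Soundness.
Local Open Scope classical_set_scope.
Variable P : Type.

Lemma sat_ImpE (M : model P) (s : M) (a b : form P) :
  sat s (Imp a b) <-> (sat s a -> sat s b).
Proof.
rewrite /=; split=> [nab sa|ab [sa]]; last by apply; exact: ab.
by apply: contrapT => nsb; apply: nab.
Qed.

Lemma sat_psubst (M : model P) (s : M) (f : nat -> form P) (t : pform) :
  sat s (psubst f t) <-> peval (fun i => `[< sat s (f i) >]) t.
Proof.
elim: t => [i|t IHt|t IHt u IHu] /=.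
- exact: (rwP (asboolP _)).
- by rewrite IHt; exact: (rwP negP).
- by rewrite IHt IHu; exact: (rwP andP).
Qed.

Lemma sat_W_ext (M : model P) (s : M) (a b : form P) :
  [set t : M | sat t a] = [set t : M | sat t b] -> sat s (W a) -> sat s (W b).
Proof. by move=> ab [Na nsa]; split; rewrite -ab. Qed.

Lemma sound_provable (Ax : form P -> Prop) (C : frame -> Prop) :
    (forall a, Ax a -> forall M : model P, C M -> forall s : M, sat s a) ->
  sound (provable Ax) C.
Proof.
move=> Ax_sound a.
elim=> {a} [_ [t [f [tt ->]]]|_ [b ->]|a Axa|a b _ ab _ IHa|a b _ ab] M CM s.
- exact/sat_psubst/tt.
- by apply/sat_ImpE => -[].
- exact: Ax_sound.
- by have /sat_ImpE := ab M CM s; apply; exact: IHa.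
(* The premise of [REW] holds at every state of [M], not just at [s], which makes the two truth sets
   equal. *)
- suff eq_ab : [set t : M | sat t a] = [set t : M | sat t b].
    by split; apply/sat_ImpE; apply: sat_W_ext.
  by apply/seteqP; split=> t /=; have [/sat_ImpE + /sat_ImpE +] := ab M CM t.
Qed.

Lemma sat_WM (M : model P) : frame_m M ->
  forall a, WM a -> forall s : M, sat s a.
Proof.
move=> Mm _ [b [c ->]] s; apply/sat_ImpE => -[[Nbc _] nsc]; split=> //.
by apply: Mm Nbc _ => t [].
Qed.

Lemma sat_WC (M : model P) : frame_c M ->
  forall a, WC a -> forall s : M, sat s a.
Proof.
move=> Mc _ [b [c ->]] s; apply/sat_ImpE => -[[Nb nsb] [Nc _]].
by split; [exact: Mc Nb Nc|case].
Qed.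

End Soundness.

(* [p] witnesses that the set [P] of propositional variables is nonempty. *)
Theorem corollary5p30 (P : Type) (p : P) :
  [/\ sound (@EW P) frame_n /\ strongly_complete p (@EW P) frame_n,
      sound (@MW P) frame_mn /\ strongly_complete p (@MW P) frame_mn
    & sound (@ECW P) frame_cn /\ strongly_complete p (@ECW P) frame_cn].
Proof.
split; split.
- exact: sound_provable.
- by apply: strongly_complete_canonical (@min_nbhdP _ _ _) _ => s0 s; left.
- by apply: sound_provable => a aWM M [Mm _] s; apply: sat_WM.
- apply: strongly_complete_canonical; first by move=> s a; apply: mon_nbhdP.
  move=> s0; split=> [s X Y [Z NZ ZX] XY|s].
    by exists Z => // t /ZX/XY.
  by exists setT => //; left.
- by apply: sound_provable => a aWC M [Mc _] s; apply: sat_WC.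
- apply: strongly_complete_canonical (@min_nbhdP _ _ _) _ => s0.
  by split=> s; [move=> X Y; apply: min_nbhd_setI|left].
Qed.
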